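(* Consider an Abel equation $$\frac{dx}{dt}=f_0(t)+f_1(t)x+f_2(t)x^2+f_3(t)x^3$$ with $f_3(t)>0$ for every $t\in\mathbb{R}$. It is a quasi-Lie system with respect to the quasi-Lie scheme $S(W_{\rm Abel},V_{\rm Abel})$ and a Lie algebra $V^{(2)}_\mu$ (for some $\mu\in\mathbb{R}$) if and only if $$9 f_3 \left(3 f_0 f_3+\dot f_2\right)-9 f_2 \left(f_1 f_3+\dot f_3\right)+2 f_2^3= 0 .$$
   Context: All functions are smooth functions of $t\in\mathbb{R}$; a dot denotes $d/dt$. Let $Y_k=x^k\,\partial/\partial x$ on $\mathbb{R}$, $V_{\rm Abel}=\langle Y_0,Y_1,Y_2,Y_3\rangle$ and $W_{\rm Abel}=\langle Y_0,Y_1\rangle$; these form a quasi-Lie scheme, i.e. $[W_{\rm Abel},W_{\rm Abel}]\subset W_{\rm Abel}\subset V_{\rm Abel}$ and $[W_{\rm Abel},V_{\rm Abel}]\subset V_{\rm Abel}$. For $\mu\in\mathbb{R}$, $V^{(2)}_\mu$ is the Lie algebra spanned by $$Z_1=-2\mu^3Y_0+3\mu Y_2+Y_3,\qquad Z_2=\mu Y_0+Y_1 .$$ The group $G_{W_{\rm Abel}}=\mathbb{R}\rtimes\mathbb{R}_*$ ($\mathbb{R}_*=\mathbb{R}\setminus\{0\}$) acts on $\mathbb{R}$ by $(\beta,\alpha)\cdot x=\alpha x+\beta$. The equation is identified with the $t$-dependent vector field $X=\sum_{k=0}^3f_k(t)Y_k$. A curve $g$ in $G_{W_{\rm Abel}}$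 acts on $X$ by $(g_\bigstar X)_t=\frac{\partial g_t}{\partial t}\circ g_t^{-1}+g_{t*}X_t$; in other words, if $g^{-1}_t=(\beta(t),\alpha(t))$ with $\alpha(t)\ne0$, then $g_\bigstar X$ is the $t$-dependent vector field of the equation obtained for $\bar x$ after the change of variables $x=\alpha(t)\bar x+\beta(t)$. The equation $X$ is a quasi-Lie system with respect to $S(W_{\rm Abel},V_{\rm Abel})$ and a Lie algebra $V_0\subset V_{\rm Abel}$ if there is a curve $g$ in $G_{W_{\rm Abel}}$ such that $(g_\bigstar X)_t\in V_0$ for all $t$. *)

(* Defs.v *)
From Stdlib Require Import Reals List Lra.
From Coquelicot Require Import Coquelicot.
Import ListNotations.
Open Scope R_scope.

Definition smooth (f : R -> R) : Prop :=
  forall (n : nat) (t : R), ex_derive_n f n t.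

(** A vector field [X(x) d/dx] on the line is identified with its coefficient
    function [X]; smoothness is imposed in [fin_dim_space]. *)
Definition vfield : Type := R -> R.

Definition lie_bracket (X Y : vfield) : vfield :=
  fun x => X x * Derive Y x - Y x * Derive X x.

Fixpoint lincomb (c : list R) (l : list vfield) : vfield :=
  fun x =>
    match c, l with
    | a :: c', Z :: l' => a * Z x + lincomb c' l' x
    | _, _ => 0
    end.

Definition span (l : list vfield) (X : vfield) : Prop :=
  exists c : list R, length c = length l /\ forall x, X x = lincomb c l x.

Definition fin_dim_space (V : vfield -> Prop) : Prop :=
  exists l : list vfield,
    (forall Z, In Z l -> smooth Z) /\ (forall X, V X <-> span l X).

Definition vf_incl (V1 V2 : vfield -> Prop) : Prop := forall X, V1 X -> V2 X.

Definition bracket_incl (V1 V2 V3 : vfield -> Prop) : Prop :=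
  forall X Y, V1 X -> V2 Y -> V3 (lie_bracket X Y).

Definition lie_algebra (V : vfield -> Prop) : Prop :=
  fin_dim_space V /\ bracket_incl V V V.

Definition quasi_lie_scheme (W V : vfield -> Prop) : Prop :=
  fin_dim_space W /\ fin_dim_space V /\ vf_incl W V /\
  bracket_incl W W W /\ bracket_incl W V V.

Definition Y (k : nat) : vfield := fun x => x ^ k.

Definition V_Abel : vfield -> Prop := span [Y 0; Y 1; Y 2; Y 3].
Definition W_Abel : vfield -> Prop := span [Y 0; Y 1].

Definition Z1 (mu : R) : vfield :=
  fun x => - 2 * mu ^ 3 * Y 0 x + 3 * mu * Y 2 x + Y 3 x.
Definition Z2 (mu : R) : vfield := fun x => mu * Y 0 x + Y 1 x.
Definition V2 (mu : R) : vfield -> Prop := span [Z1 mu; Z2 mu].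

(** The semidirect product of [R] and [R_*], elements being written
    [(beta, alpha)]. *)
Record G_W_Abel : Type := mkG {
  beta : R;
  alpha : R;
  alpha_neq0 : alpha <> 0
}.

Definition act (g : G_W_Abel) (x : R) : R := alpha g * x + beta g.

Definition G_mul (g h : G_W_Abel) : G_W_Abel :=
  mkG (alpha g * beta h + beta g) (alpha g * alpha h)
      (Rmult_integral_contrapositive_currified _ _ (alpha_neq0 g) (alpha_neq0 h)).

Definition G_one : G_W_Abel := mkG 0 1 R1_neq_R0.

Definition G_inv (g : G_W_Abel) : G_W_Abel :=
  mkG (- (beta g / alpha g)) (/ alpha g) (Rinv_neq_0_compat _ (alpha_neq0 g)).

Lemma act_one x : act G_one x = x.
Proof. unfold act; simpl; ring. Qed.

Lemma act_mul g h x : act (G_mul g h) x = act g (act h x).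
Proof. unfold act; simpl; ring. Qed.

Lemma act_invK g x : act (G_inv g) (act g x) = x.
Proof. unfold act; simpl; field; apply alpha_neq0. Qed.

Lemma act_Kinv g x : act g (act (G_inv g) x) = x.
Proof. unfold act; simpl; field; apply alpha_neq0. Qed.

Definition smooth_curve (g : R -> G_W_Abel) : Prop :=
  smooth (fun t => beta (g t)) /\ smooth (fun t => alpha (g t)).

Definition pushforward (g : G_W_Abel) (X : vfield) : vfield :=
  fun x => Derive (act g) (act (G_inv g) x) * X (act (G_inv g) x).

(** [(g_bigstar X)_t = (d g_t / dt) o g_t^-1 + (g_t)_* X_t]. *)
Definition gstar (g : R -> G_W_Abel) (X : R -> vfield) : R -> vfield :=
  fun t x =>
    Derive (fun s => act (g s) (act (G_inv (g t)) x)) t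
    + pushforward (g t) (X t) x.

Definition abel (f0 f1 f2 f3 : R -> R) : R -> vfield :=
  fun t x => f0 t * Y 0 x + f1 t * Y 1 x + f2 t * Y 2 x + f3 t * Y 3 x.

Definition quasi_lie_system (X : R -> vfield) (V0 : vfield -> Prop) : Prop :=
  quasi_lie_scheme W_Abel V_Abel /\
  (forall t, V_Abel (X t)) /\
  lie_algebra V0 /\ vf_incl V0 V_Abel /\
  exists g : R -> G_W_Abel,
    smooth_curve g /\ forall t, V0 (gstar g X t).

(* Main.v *)
(** Since [Z1 mu = (x + mu)^3 - 3 mu^2 (x + mu)], the algebra [V2 mu] is spanned
    by [(x + mu)^3] and [x + mu].  A change of variables [y = a x + b] brings the
    equation into [V2 mu] iff [a' x + b' + a (f0 + f1 x + f2 x^2 + f3 x^3)] is a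
    combination of [(x + c)^3] and [x + c], where [c = (b + mu) / a].  The two
    leading coefficients force [c = f2 / (3 f3)], and the remaining two amount to
    [c' + f0 = f1 c - 2 f3 c^3], which is the stated condition.  Conversely, [c]
    is realized by [mu = 0], [a = f3], [b = f2 / 3]. *)
Require Import Defs.
From Stdlib Require Import Reals List Lra.
From Coquelicot Require Import Coquelicot.
Import ListNotations.
Open Scope R_scope.

Lemma smooth_plus (f g : R -> R) :
  smooth f -> smooth g -> smooth (fun t => f t + g t).
Proof.
intros hf hg n t; apply ex_derive_n_plus;
  apply filter_forall; intros s k _; [apply hf | apply hg].
Qed.

Lemma smooth_scal (a : R) (f : R -> R) : smooth f -> smooth (fun t => a * f t).
Proof. intros hf n t; apply ex_derive_n_scal_l, hf. Qed.

Lemma smooth_Y (k : nat) : smooth (Y k).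
Proof. intros n t; apply ex_derive_n_pow. Qed.

Lemma smooth_ex_derive (f : R -> R) (t : R) : smooth f -> ex_derive f t.
Proof. intros hf; exact (hf 1%nat t). Qed.

Lemma fin_dim_span (l : list vfield) :
  (forall Z, In Z l -> smooth Z) -> fin_dim_space (span l).
Proof. intros hl; exists l; split; [exact hl | reflexivity]. Qed.

Lemma W_AbelE (X : vfield) :
  W_Abel X <-> exists a b, forall x, X x = a + b * x.
Proof.
split.
- intros [[|a [|b [|]]] [hl hX]]; try discriminate hl.
  exists a, b; intros x; rewrite hX; unfold Y; simpl; ring.
- intros [a [b hX]]; exists [a; b]; split; [reflexivity|].
  intros x; rewrite hX; unfold Y; simpl; ring.
Qed.

Lemma V_AbelE (X : vfield) :
  V_Abel X <->
  exists a b c d, forall x, X x = a + b * x + c * x ^ 2 + d * x ^ 3.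
Proof.
split.
- intros [[|a [|b [|c [|d [|]]]]] [hl hX]]; try discriminate hl.
  exists a, b, c, d; intros x; rewrite hX; unfold Y; simpl; ring.
- intros [a [b [c [d hX]]]]; exists [a; b; c; d]; split; [reflexivity|].
  intros x; rewrite hX; unfold Y; simpl; ring.
Qed.

(** The basis [(x + mu)^3], [x + mu] makes brackets and affine substitutions easy to compute. The
    term [3 * mu ^ 2] in the witnesses is the change of basis from [Z1], [Z2]. *)
Lemma V2E (mu : R) (X : vfield) :
  V2 mu X <-> exists p q, forall x, X x = p * (x + mu) ^ 3 + q * (x + mu).
Proof.
split.
- intros [[|a [|b [|]]] [hl hX]]; try discriminate hl.
  exists a, (b - 3 * mu ^ 2 * a); intros x; rewrite hX.
  simpl; unfold Z1, Z2, Y; ring.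
- intros [p [q hX]]; exists [p; q + 3 * mu ^ 2 * p]; split; [reflexivity|].
  intros x; rewrite hX; simpl; unfold Z1, Z2, Y; ring.
Qed.

(** Membership in a span is a pointwise equality, so this is what allows a field to be replaced by
    its polynomial form under the bracket. *)
Lemma lie_bracket_ext (X X' Z Z' : vfield) (x : R) :
  (forall y, X y = X' y) -> (forall y, Z y = Z' y) ->
  lie_bracket X Z x = lie_bracket X' Z' x.
Proof.
intros hX hZ; unfold lie_bracket.
now rewrite hX, hZ, (Derive_ext _ _ x hX), (Derive_ext _ _ x hZ).
Qed.

Lemma Derive_cubic (a b c d x : R) :
  Derive (fun y => a + b * y + c * y ^ 2 + d * y ^ 3) x
  = b + 2 * c * x + 3 * d * x ^ 2.
Proof. apply is_derive_unique; auto_derive; [exact I | ring]. Qed.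

Lemma Derive_affine (a b x : R) : Derive (fun y => a + b * y) x = b.
Proof. apply is_derive_unique; auto_derive; [exact I | ring]. Qed.

Lemma scheme_Abel : quasi_lie_scheme W_Abel V_Abel.
Proof.
assert (hY : forall l Z, In Z (map Y l) -> smooth Z).
{ intros l Z h; apply in_map_iff in h; destruct h as [k [<- _]].
  apply smooth_Y. }
split; [|split; [|split; [|split]]].
- exact (fin_dim_span _ (hY [0; 1]%nat)).
- exact (fin_dim_span _ (hY [0; 1; 2; 3]%nat)).
- intros X hX; apply W_AbelE in hX; destruct hX as [a [b hX]].
  apply V_AbelE; exists a, b, 0, 0; intros x; rewrite hX; ring.
- intros X Z hX hZ; apply W_AbelE in hX, hZ.
  destruct hX as [a [b hX]], hZ as [a' [b' hZ]].
  apply W_AbelE; exists (a * b' - a' * b), 0; intros x.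
  rewrite (lie_bracket_ext _ _ _ _ x hX hZ); unfold lie_bracket.
  rewrite !Derive_affine; ring.
- intros X Z hX hZ; apply W_AbelE in hX; apply V_AbelE in hZ.
  destruct hX as [a [b hX]], hZ as [a' [b' [c' [d' hZ]]]].
  apply V_AbelE.
  exists (a * b' - a' * b), (2 * a * c'), (3 * a * d' + b * c'), (2 * b * d').
  intros x.
  rewrite (lie_bracket_ext _ _ _ _ x hX hZ); unfold lie_bracket.
  rewrite Derive_affine, Derive_cubic; ring.
Qed.

Lemma lie_algebra_V2 (mu : R) : lie_algebra (V2 mu).
Proof.
split.
- apply fin_dim_span; intros Z [<- | [<- | []]].
  + apply smooth_plus; [apply smooth_plus|]; try apply smooth_scal; apply smooth_Y.
  + apply smooth_plus; [apply smooth_scal|]; apply smooth_Y.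
- intros X Z hX hZ; apply V2E in hX, hZ.
  destruct hX as [p [q hX]], hZ as [p' [q' hZ]].
  (* With [u = x + mu], the bracket of [u^3] and [u] is [-2 u^3]; bilinearity and antisymmetry give
     the coefficient. *)
  apply V2E; exists (2 * (q * p' - p * q')), 0; intros x.
  assert (hD : forall r s : R,
    Derive (fun y => r * (y + mu) ^ 3 + s * (y + mu)) x
    = 3 * r * (x + mu) ^ 2 + s).
  { intros r s; apply is_derive_unique; auto_derive; [exact I | ring]. }
  rewrite (lie_bracket_ext _ _ _ _ x hX hZ); unfold lie_bracket.
  rewrite !hD; ring.
Qed.

Lemma V2_incl_V_Abel (mu : R) : vf_incl (V2 mu) V_Abel.
Proof.
intros X hX; apply V2E in hX; destruct hX as [p [q hX]].
apply V_AbelE.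
exists (p * mu ^ 3 + q * mu), (3 * p * mu ^ 2 + q), (3 * p * mu), p.
intros x; rewrite hX; ring.
Qed.

Lemma V_Abel_abel (f0 f1 f2 f3 : R -> R) (t : R) : V_Abel (abel f0 f1 f2 f3 t).
Proof.
apply V_AbelE; exists (f0 t), (f1 t), (f2 t), (f3 t); intros x.
unfold abel, Y; ring.
Qed.

(** Evaluating at the image point [act (g t) x] cancels every inverse, and the derivative of the
    affine map [act (g t)] is the constant [alpha (g t)]. *)
Lemma gstar_act (g : R -> G_W_Abel) (X : R -> vfield) (t x : R) :
  smooth_curve g ->
  gstar g X t (act (g t) x)
  = Derive (fun s => alpha (g s)) t * x + Derive (fun s => beta (g s)) t
    + alpha (g t) * X t x.
Proof.
intros [hb ha]; unfold gstar, pushforward; rewrite act_invK; unfold act.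
pose proof (smooth_ex_derive _ t ha) as da.
pose proof (smooth_ex_derive _ t hb) as db.
rewrite Derive_plus; [|now apply ex_derive_mult; [|apply ex_derive_const] | exact db].
rewrite Derive_scal_l.
f_equal; f_equal.
apply is_derive_unique; auto_derive; [exact I | ring].
Qed.

Lemma cubic_coeffs (a b c d a' b' c' d' : R) :
  (forall x, a + b * x + c * x ^ 2 + d * x ^ 3
             = a' + b' * x + c' * x ^ 2 + d' * x ^ 3) ->
  a = a' /\ b = b' /\ c = c' /\ d = d'.
Proof.
intros h.
(* Four distinct nodes determine a cubic, so the rest is linear algebra. *)
pose proof (h 0); pose proof (h 1); pose proof (h (-1)); pose proof (h 2).
repeat split; lra.
Qed.

Lemma abel_condition_of_V2 (f0 f1 f2 f3 : R -> R) (mu : R) (g : R -> G_W_Abel) :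
  smooth f2 -> smooth f3 -> (forall t, 0 < f3 t) -> smooth_curve g ->
  (forall t, V2 mu (gstar g (abel f0 f1 f2 f3) t)) ->
  forall t,
    9 * f3 t * (3 * f0 t * f3 t + Derive f2 t)
    - 9 * f2 t * (f1 t * f3 t + Derive f3 t)
    + 2 * f2 t ^ 3 = 0.
Proof.
intros hf2 hf3 f3_pos hg hV.
set (a := fun s => alpha (g s)); set (b := fun s => beta (g s)).
(* Coefficients are compared in the original variable [x], where the new variable shifted by [mu] is
   [a t * x + (b t + mu)]. *)
assert (hco : forall t, exists p q,
  Derive b t + a t * f0 t = p * (b t + mu) ^ 3 + q * (b t + mu) /\
  Derive a t + a t * f1 t = 3 * p * a t * (b t + mu) ^ 2 + q * a t /\
  a t * f2 t = 3 * p * a t ^ 2 * (b t + mu) /\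
  a t * f3 t = p * a t ^ 3).
{ intros t; destruct (proj1 (V2E _ _) (hV t)) as [p [q h]]; exists p, q.
  apply cubic_coeffs; intros x; specialize (h (act (g t) x)).
  rewrite (gstar_act _ _ _ _ hg) in h; fold a b in h.
  unfold abel, Y, act in h; fold (a t) (b t) in h.
  etransitivity; [|etransitivity; [exact h|]]; ring. }
(* Eliminating [p] between the two leading coefficients gives a division-free relation; being valid
   for all [t], it can be differentiated. *)
assert (hlead : forall t, f2 t * a t = 3 * (f3 t * (b t + mu))).
{ intros t; destruct (hco t) as [p [q [_ [_ [h2 h3]]]]].
  pose proof (alpha_neq0 (g t) : a t <> 0) as ha.
  apply (Rmult_eq_reg_l (a t)); [|exact ha].
  replace (a t * (f2 t * a t)) with (a t * f2 t * a t) by ring.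
  replace (a t * (3 * (f3 t * (b t + mu))))
    with (3 * (b t + mu) * (a t * f3 t)) by ring.
  rewrite h2, h3; ring. }
intros t.
pose proof (alpha_neq0 (g t) : a t <> 0) as ha.
pose proof (f3_pos t) as h3pos.
assert (hD : Derive f2 t * a t + f2 t * Derive a t
             = 3 * (Derive f3 t * (b t + mu) + f3 t * Derive b t)).
{ destruct hg as [hb ha'].
  pose proof (smooth_ex_derive _ t ha' : ex_derive a t) as da.
  pose proof (smooth_ex_derive _ t hb : ex_derive b t) as db.
  pose proof (smooth_ex_derive _ t hf2) as d2.
  pose proof (smooth_ex_derive _ t hf3) as d3.
  rewrite <- (Derive_mult f2 a) by assumption.
  rewrite (Derive_ext _ _ t hlead), Derive_scal, Derive_mult;
    [|assumption|apply @ex_derive_plus; [assumption|apply ex_derive_const]].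
  rewrite Derive_plus, Derive_const; [ring|assumption|apply ex_derive_const]. }
destruct (hco t) as [p [q [h0 [h1 [_ h3]]]]]; specialize (hlead t).
set (e := b t + mu) in *.
(* The relations are solved in turn: the cubic coefficient for [p], [hlead] for [e], the linear
   coefficient for [q], the constant one for the derivative of [b], and [hD] for that of [f2].
   Substitution leaves a rational identity. *)
assert (ep : p = f3 t / a t ^ 2).
{ apply (Rmult_eq_reg_l (a t ^ 3)); [|now apply pow_nonzero].
  rewrite (Rmult_comm _ p), <- h3; field; exact ha. }
assert (ee : e = f2 t * a t / (3 * f3 t)) by (rewrite hlead; field; lra).
assert (eq : q = (Derive a t + a t * f1 t - 3 * p * a t * e ^ 2) / a t)
  by (rewrite h1; field; exact ha).
assert (eb : Derive b t = p * e ^ 3 + q * e - a t * f0 t) by lra.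
assert (ef : Derive f2 t
  = (3 * (Derive f3 t * e + f3 t * Derive b t) - f2 t * Derive a t) / a t)
  by (rewrite <- hD; field; exact ha).
rewrite ef, eb, eq, ep, ee; field; split; [lra | exact ha].
Qed.

Lemma V2_of_abel_condition (f0 f1 f2 f3 : R -> R) :
  smooth f2 -> smooth f3 -> (forall t, 0 < f3 t) ->
  (forall t,
    9 * f3 t * (3 * f0 t * f3 t + Derive f2 t)
    - 9 * f2 t * (f1 t * f3 t + Derive f3 t)
    + 2 * f2 t ^ 3 = 0) ->
  exists g, smooth_curve g /\ forall t, V2 0 (gstar g (abel f0 f1 f2 f3) t).
Proof.
intros hf2 hf3 f3_pos hcond.
exists (fun t => mkG (/ 3 * f2 t) (f3 t) (Rgt_not_eq _ _ (f3_pos t))).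
set (g := fun t => _).
assert (hg : smooth_curve g) by (split; [now apply smooth_scal | exact hf3]).
split; [exact hg|]; intros t; apply V2E.
(* These values are forced by the cubic and linear coefficients when [a = f3], [b = f2 / 3] and
   [mu = 0]. *)
exists (/ f3 t),
  (f1 t + Derive f3 t / f3 t - f2 t ^ 2 / (3 * f3 t)); intros y.
pose proof (f3_pos t) as h3.
(* Every point [y] is the image of some [x], so the identity may be checked in [x]. *)
rewrite <- (act_Kinv (g t) y), (gstar_act _ _ _ _ hg).
generalize (act (G_inv (g t)) y); intros x; unfold act, abel, Y; simpl.
rewrite Derive_scal.
(* The condition, solved for the derivative of [f2], is exactly what matches the constant
   coefficient. *)
assert (ef : Derive f2 t =
  (9 * f2 t * (f1 t * f3 t + Derive f3 t) - 2 * f2 t ^ 3) / (9 * f3 t)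
  - 3 * f0 t * f3 t).
{ apply (Rmult_eq_reg_l (9 * f3 t)); [|lra].
  field_simplify; [|lra]; specialize (hcond t); lra. }
change (Derive (fun s => f3 s) t) with (Derive f3 t).
change (Derive (fun s => f2 s) t) with (Derive f2 t).
rewrite ef; field; lra.
Qed.

Theorem theorem7p1 (f0 f1 f2 f3 : R -> R)
  (hf0 : smooth f0) (hf1 : smooth f1) (hf2 : smooth f2) (hf3 : smooth f3)
  (f3_pos : forall t : R, 0 < f3 t) :
  (exists mu : R, quasi_lie_system (abel f0 f1 f2 f3) (V2 mu)) <->
  (forall t : R,
     9 * f3 t * (3 * f0 t * f3 t + Derive f2 t)
     - 9 * f2 t * (f1 t * f3 t + Derive f3 t)
     + 2 * f2 t ^ 3 = 0).
Proof.
split.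
- intros [mu [_ [_ [_ [_ [g [hg hV]]]]]]].
  exact (abel_condition_of_V2 f0 f1 f2 f3 mu g hf2 hf3 f3_pos hg hV).
(* Translations in the group carry the algebras [V2 mu] into one another, so [mu = 0] is no
   restriction. *)
- intros hcond; exists 0.
  split; [exact scheme_Abel|].
  split; [intros t; apply V_Abel_abel|].
  split; [apply lie_algebra_V2|].
  split; [apply V2_incl_V_Abel|].
  now apply V2_of_abel_condition.
Qed.
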